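(* Assume that $n\ge 2$. Then there does not exist a homogeneous, codimension-one regular foliation of $\mathbb{R}^n\setminus\{0\}$ that is transversal to the radial direction and whose leaves are (all) dense in $\mathbb{R}^n\setminus\{0\}$.
   Context: A foliation of a manifold $X$ is a partition of $X$ into connected immersed submanifolds, called leaves. A foliation is regular if all its leaves have the same dimension $d$ and, around each point of $X$, there are smooth local coordinates in which the foliation is trivialized in the form $\{\omega+p\mid p\in P\}$, for some connected submanifold $\omega\subset\mathbb{R}^{\dim X}$ of dimension $d$ and some connected submanifold $P$ of dimension $\dim X-d$ transversal to $\omega$ (i.e. it is a smooth foliation of dimension $d$ in the usual sense). It has codimension one if $d=\dim X-1$. For a foliation of $\mathbb{R}^n\setminus\{0\}$, let $L_x$ denote the leaf through $x$. The foliation is homogeneous if $\lambda L_x=L_{\lambda x}$ for all $\lambda>0$ and all $x\in\mathbb{R}^n\setminus\{0\}$. It is transversal to the radial direction if $T_yL_y+\mathbb{R}y=\mathbb{R}^n$ for every $y\in\mathbb{R}^n\setminus\{0\}$. *)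

(* Defs.v *)
From HB Require Import structures.
From mathcomp Require Import all_boot all_order all_algebra.
From mathcomp Require Import all_classical all_reals all_analysis.
Set Implicit Arguments.
Unset Strict Implicit.
Unset Printing Implicit Defensive.
Import Order.TTheory GRing.Theory Num.Theory.
Import numFieldNormedType.Exports.
Local Open Scope classical_set_scope.
Local Open Scope ring_scope.

(* C^k on U by induction on k.  In finite dimension, f is C^(k+1) on an open
   set iff it is differentiable there and x |-> ('d f x v) is C^k for every v.
   Only used for U open. *)
Fixpoint Ck_on (R : realType) (V W : normedModType R) (k : nat)
    (U : set V) (f : V -> W) : Prop :=
  match k with
  | 0%N => forall x, U x -> {for x, continuous f}
  | k'.+1 => (forall x, U x -> differentiable f x) /\
             (forall v : V, Ck_on k' U (fun x => 'd f x v))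
  end.

Definition smooth_on (R : realType) (V W : normedModType R)
    (U : set V) (f : V -> W) : Prop :=
  forall k, Ck_on k U f.

(* g restricted to the open set W of R^d is an inverse chart of the topological
   space M (a homeomorphism onto an open subset) in which iota : M -> R^n is a
   smooth immersion.  The values of g outside W are irrelevant. *)
Definition local_parametrization (R : realType) (n d : nat)
    (M : topologicalType) (iota : M -> 'rV[R]_n)
    (W : set 'rV[R]_d) (g : 'rV[R]_d -> M) : Prop :=
  [/\ open W,
      set_inj W g,
      (forall w, W w -> {for w, continuous g}),
      (forall O, O `<=` W -> open O -> open (g @` O)) &
      smooth_on W (iota \o g) /\
      forall w, W w -> injective ('d (iota \o g) w)].

(* An immersed submanifold of R^n is a subset endowed with a (possibly finer)
   manifold topology and a smooth structure for which the inclusion is a smooth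
   immersion; here the subset is the range of the injection im_incl.  Given the
   topology, the smooth structure making the inclusion an immersion is unique:
   it is the one whose inverse charts are all the local parametrizations.  The
   space is Hausdorff, since im_incl is injective and continuous. *)
Record immersed_submanifold (R : realType) (n : nat) := ImmersedSubmanifold {
  im_space : topologicalType;
  im_dim : nat;
  im_incl : im_space -> 'rV[R]_n;
  im_incl_inj : injective im_incl;
  im_second_countable : @second_countable im_space;
  im_charts : forall m : im_space,
    exists (W : set 'rV[R]_im_dim) (g : 'rV[R]_im_dim -> im_space),
      local_parametrization im_incl W g /\ (g @` W) m
}.

Definition carrier (R : realType) (n : nat) (M : immersed_submanifold R n) :
  set 'rV[R]_n := range (@im_incl R n M).

Definition tangent_space (R : realType) (n : nat)
    (M : immersed_submanifold R n) (m : im_space M) : set 'rV[R]_n :=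
  [set v | exists (W : set 'rV[R]_(im_dim M))
      (g : 'rV[R]_(im_dim M) -> im_space M) (w u : 'rV[R]_(im_dim M)),
      [/\ local_parametrization (@im_incl R n M) W g, W w, g w = m &
          v = 'd (@im_incl R n M \o g) w u]].

Definition connected_submanifold (R : realType) (n : nat)
    (M : immersed_submanifold R n) : Prop :=
  connected [set: im_space M].

(* Embedded: the manifold topology is the one induced by R^n. *)
Definition embedded (R : realType) (n : nat)
    (M : immersed_submanifold R n) : Prop :=
  forall O : set (im_space M), open O ->
    exists2 B : set 'rV[R]_n, open B & O = @im_incl R n M @^-1` B.

(* A foliation of the open set X: a partition of X into connected immersed
   submanifolds, which may have different dimensions.  (partition includes that
   the blocks are nonempty.) *)
Record foliation (R : realType) (n : nat) (X : set 'rV[R]_n) := Foliation {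
  leaf_index : Type;
  leaf : leaf_index -> immersed_submanifold R n;
  leaf_connected : forall i, connected_submanifold (leaf i);
  leaf_partition : partition [set: leaf_index] (fun i => carrier (leaf i)) X
}.
Arguments leaf {R n X} f i.

(* The underlying set of the leaf L_x, for x in X. *)
Definition leaf_through (R : realType) (n : nat) (X : set 'rV[R]_n)
    (F : foliation X) (x : 'rV[R]_n) : set 'rV[R]_n :=
  \bigcup_(i in [set i | carrier (leaf F i) x]) carrier (leaf F i).

Definition local_coordinates (R : realType) (n : nat)
    (U : set 'rV[R]_n) (phi : 'rV[R]_n -> 'rV[R]_n) : Prop :=
  [/\ open U, open (phi @` U), smooth_on U phi &
      exists2 psi : 'rV[R]_n -> 'rV[R]_n,
        smooth_on (phi @` U) psi & {in U, cancel phi psi}].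

(* The leaves of the foliation induced on U: the connected components, for the
   leaf topology, of the traces on U of the leaves. *)
Definition plaques (R : realType) (n : nat) (X : set 'rV[R]_n)
    (F : foliation X) (U : set 'rV[R]_n) : set (set 'rV[R]_n) :=
  [set C | exists (i : leaf_index F) (m : im_space (leaf F i)),
     U (im_incl m) /\
     C = @im_incl R n (leaf F i) @`
           connected_component (@im_incl R n (leaf F i) @^-1` U) m].

(* Since the model leaves are the translates omega + p, transversality of P to
   omega means that T_x(omega + p) = T_x omega and T_p P span R^n for all x in
   omega and p in P. *)
Definition transversal (R : realType) (n : nat)
    (omega P : immersed_submanifold R n) : Prop :=
  forall (x : im_space omega) (p : im_space P) (v : 'rV[R]_n),
    exists s t, [/\ tangent_space x s, tangent_space p t & v = s + t].

Definition regular_foliation (R : realType) (n : nat) (X : set 'rV[R]_n)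
    (F : foliation X) (d : nat) : Prop :=
  (forall i, im_dim (leaf F i) = d) /\
  forall x, X x ->
    exists (U : set 'rV[R]_n) (phi : 'rV[R]_n -> 'rV[R]_n)
           (omega P : immersed_submanifold R n),
      [/\ U x /\ U `<=` X,
          local_coordinates U phi,
          [/\ embedded omega, connected_submanifold omega & im_dim omega = d],
          [/\ embedded P, connected_submanifold P, im_dim P = (n - d)%N &
              transversal omega P] &
          [set phi @` C | C in plaques F U] =
          [set [set w + p | w in carrier omega] | p in carrier P]].

Definition codimension_one_regular (R : realType) (n : nat)
    (X : set 'rV[R]_n) (F : foliation X) : Prop :=
  exists2 d : nat, d.+1 = n & regular_foliation F d.

Definition punctured_space (R : realType) (n : nat) : set 'rV[R]_n :=
  [set x | x != 0].
Arguments punctured_space : clear implicits.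

Definition homogeneous (R : realType) (n : nat)
    (F : foliation (punctured_space R n)) : Prop :=
  forall (lambda : R) (x : 'rV[R]_n), 0 < lambda -> punctured_space R n x ->
    [set lambda *: y | y in leaf_through F x] = leaf_through F (lambda *: x).

Definition transversal_to_radial (R : realType) (n : nat)
    (F : foliation (punctured_space R n)) : Prop :=
  forall (i : leaf_index F) (m : im_space (leaf F i)) (v : 'rV[R]_n),
    exists (t : 'rV[R]_n) (r : R),
      tangent_space m t /\ v = t + r *: im_incl m.

Definition all_leaves_dense (R : realType) (n : nat) (X : set 'rV[R]_n)
    (F : foliation X) : Prop :=
  forall i : leaf_index F, X `<=` closure (carrier (leaf F i)).

(* Main.v *)
(* Let L be a leaf.  By homogeneity the dilates e^s L are leaves, so the set T(y)
   of all s with y in e^s L is empty or a coset of the group G of all s with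
   e^s L = L.  Transversality makes (m, s) |-> e^s m a local diffeomorphism from
   L x R to R^n; hence the points of L on a given ray are isolated in L, and G is
   countable because L is second countable.  It also shows, L being dense, that T
   has local continuous selections near every point of R^n \ {0}; two of them
   differ by a continuous G-valued function, which is constant on connected sets.

   Consequently T has continuous selections h and h' on R^n slit along the
   negative, respectively the positive, first half-axis: both domains are
   star-shaped.  On the common domain h' - h takes only two values after a
   normalization, namely 0 and some a.  This single period a replaces the
   fundamental group of the sphere, and covers n = 2 and n > 2 alike.  If k is a
   nonconstant continuous function of period a, then k o h = k o h' is a globally
   defined continuous function; it is constant on the connected set L, since k(G)
   is countable, and so everywhere if L is dense.  But h increases by s from y to
   e^s y. *)
Require Import Defs.
From mathcomp Require Import all_boot all_order all_algebra.
From mathcomp Require Import all_classical all_reals all_analysis.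
From mathcomp Require Import ring lra.
Set Implicit Arguments.
Unset Strict Implicit.
Unset Printing Implicit Defensive.
Import Order.TTheory GRing.Theory Num.Theory.
Import numFieldNormedType.Exports.
Local Open Scope classical_set_scope.
Local Open Scope ring_scope.

(** * Continuous selections of cosets of a countable group *)

Lemma convex_combination_lt (R : realType) (a b c t : R) :
  a < c -> b < c -> 0 <= t <= 1 -> (1 - t) * a + t * b < c.
Proof.
move=> ac bc /andP[t0 t1].
have [->|t0'] := eqVneq t 0; first by rewrite subr0 mul1r mul0r addr0.
have : 0 < t by rewrite lt_neqAle eq_sym t0'.
by nra.
Qed.

Section Liftings.
Variable R : realType.

Lemma countable_itvcc (a b : R) : countable `[a, b]%classic -> b <= a.
Proof.
move=> /countable_lebesgue_measure0; rewrite lebesgue_measure_itv /= lte_fin.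
case: ltP => // ab /eqP; rewrite -EFinD eqe subr_eq0 => /eqP ba.
by rewrite ba ltxx in ab.
Qed.

(** The image is an interval, and a countable interval, being Lebesgue null, is at most a point. *)
Lemma connected_countable_cst (T : topologicalType) (A : set T) (f : T -> R) :
  connected A -> {within A, continuous f} -> countable (f @` A) ->
  forall x y, A x -> A y -> f x = f y.
Proof.
move=> cA cf cnt.
have /connected_intervalP I := connected_continuous_connected cA cf.
suff H x y : A x -> A y -> f x <= f y.
  by move=> x y Ax Ay; apply/le_anti; rewrite !H.
move=> Ax Ay; apply: countable_itvcc; apply: sub_countable cnt.
apply: subset_card_le => z /=; rewrite in_itv /= => zI.
by apply: I zI; [exists y | exists x].
Qed.

Variable V : normedModType R.

Definition affine_path (x y : V) (t : R) : V := x + t *: (y - x).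

Definition segment_closed (C : set V) :=
  forall x y t, C x -> C y -> 0 <= t <= 1 -> C (affine_path x y t).

Lemma affine_path_continuous (x y : V) : continuous (affine_path x y).
Proof.
move=> t; apply: cvgD; first exact: cvg_cst.
by apply: cvgZr_tmp; exact: cvg_id.
Qed.

Lemma segment_closed_connected (C : set V) : segment_closed C -> connected C.
Proof.
move=> cC; have [[x Cx]|C0] := pselect (C !=set0); last first.
  suff -> : C = set0 by exact: connected0.
  by apply/eqP; apply: contrapT => /negP/set0P.
have -> : C = \bigcup_(y in C) (affine_path x y @` `[0, 1]).
  apply/seteqP; split => [y Cy|z [y Cy] [t t01 <-]]; last exact: cC.
  exists y => //; exists 1; first by rewrite /= in_itv /= lexx ler01.
  by rewrite /affine_path scale1r addrC subrK.
apply: bigcup_connected => [|y Cy]; last first.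
  apply: connected_continuous_connected; first exact: segment_connected.
  exact/continuous_subspaceT/affine_path_continuous.
exists x => y Cy; exists 0; first by rewrite /= in_itv /= lexx ler01.
by rewrite /affine_path scale0r addr0.
Qed.

Variables (T : V -> set R) (G : set R).
Hypotheses (Gcount : countable G)
  (TG : forall y s s', T y s -> T y s' <-> G (s' - s)).

(** A continuous selection of [T] over an open set; by [TG] each nonempty [T y] is a translate of
    [G]. *)
Definition lifting (U : set V) (h : V -> R) :=
  open U /\ forall y, U y -> T y (h y) /\ {for y, continuous h}.

(** The difference is continuous with values in the countable set [G]. *)
Lemma lifting_sub_cst (U U' C : set V) h h' : lifting U h -> lifting U' h' ->
  connected C -> C `<=` U `&` U' ->
  forall x y, C x -> C y -> h' x - h x = h' y - h y.
Proof.
move=> [_ Uh] [_ Uh'] cC CU.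
apply: (@connected_countable_cst _ C (fun x => h' x - h x)) => //.
  apply: continuous_in_subspaceT => x /set_mem Cx.
  by have [/Uh[_ ?] /Uh'[_ ?]] := CU _ Cx; apply: cvgB.
apply: sub_countable Gcount; apply: subset_card_le => _ [x Cx <-].
by have [/Uh[Tx _] /Uh'[Tx' _]] := CU _ Cx; apply/(TG _ Tx).
Qed.

Lemma lifting_shift U h y s : lifting U h -> T y (h y) -> T y s ->
  lifting U (fun x => h x + (s - h y)).
Proof.
move=> [oU Uh] Ty Ts; split=> // x Ux; have [Tx cx] := Uh x Ux; split.
  by apply/(TG _ Tx); rewrite addrAC subrr add0r; apply/(TG _ Ty).
by apply: cvgD => //; exact: cvg_cst.
Qed.

Lemma eq_near_continuous (f g : V -> R) (x : V) (U : set V) : open U -> U x ->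
  (forall y, U y -> f y = g y) -> {for x, continuous f} -> {for x, continuous g}.
Proof.
move=> oU Ux fg cf; rewrite /prop_for /continuous_at -(fg x Ux).
apply: cvg_trans cf; apply: near_eq_cvg.
by near do apply: fg; exact: open_nbhs_nbhs.
Unshelve. all: end_near. Qed.

Lemma lifting_glue_eq U U' h h' : lifting U h -> lifting U' h' ->
  (forall y, U y -> U' y -> h y = h' y) ->
  exists2 k, lifting (U `|` U') k &
    (forall y, U y -> k y = h y) /\ (forall y, U' y -> k y = h' y).
Proof.
move=> [oU Uh] [oU' Uh'] hh'.
pose k y := if y \in U then h y else h' y.
have kU y : U y -> k y = h y by move=> Uy; rewrite /k mem_set.
have kU' y : U' y -> k y = h' y.
  by move=> U'y; rewrite /k; case: ifPn => // /set_mem Uy; exact: hh'.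
exists k => //; split; first exact: openU.
move=> y [Uy|Uy]; [have [Ty cy] := Uh y Uy|have [Ty cy] := Uh' y Uy]; split.
- by rewrite kU.
- by apply: (eq_near_continuous oU Uy) cy => z /kU.
- by rewrite kU'.
- by apply: (eq_near_continuous oU' Uy) cy => z /kU'.
Qed.

(** Shifting [h'] to agree with [h] at one common point makes them agree on the whole overlap. *)
Lemma lifting_glue U U' h h' : lifting U h -> lifting U' h' ->
  connected (U `&` U') -> U `&` U' !=set0 ->
  exists k, lifting (U `|` U') k.
Proof.
move=> Lh Lh' cUU' [x [Ux U'x]].
have [Tx _] := (Lh.2 x Ux); have [T'x _] := (Lh'.2 x U'x).
have Lk := lifting_shift Lh' T'x Tx.
have [] := lifting_glue_eq Lh Lk; last by move=> k; exists k.
move=> y Uy U'y; have := @lifting_sub_cst U U' _ h h' Lh Lh' cUU' _ x y.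
by move=> /(_ (fun _ H => H) (conj Ux U'x) (conj Uy U'y)) E; lra.
Qed.

(** * Liftings along segments and on star-shaped sets *)

Definition locally_liftable (D : set V) :=
  forall x, D x -> exists2 U, U x & exists h, lifting U h.

(** The [d]-neighbourhood of the part of the segment with parameters in [[p, q]]. It is convex, so
    the intersection of two tubes is connected. *)
Definition tube (x y : V) (p q d : R) : set V :=
  [set z | exists2 t, p <= t <= q & `|affine_path x y t - z| < d].

Lemma tube_open x y p q d : open (tube x y p q d).
Proof.
have -> : tube x y p q d =
    \bigcup_(t in [set t | p <= t <= q]) ball (affine_path x y t) d.
  apply/seteqP; split=> [z [t tpq zt]|z [t tpq]].
    by exists t => //; rewrite -ball_normE.
  by rewrite -ball_normE => zt; exists t.
by apply: bigcup_open => t _; exact: ball_open.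
Qed.

Lemma tube_segment_closed x y p q d : segment_closed (tube x y p q d).
Proof.
move=> z z' r [t /andP[pt tq] zt] [t' /andP[pt' tq'] zt'] /andP[r0 r1].
exists ((1 - r) * t + r * t'); first by apply/andP; split; nra.
have -> : affine_path x y ((1 - r) * t + r * t') - affine_path z z' r =
    (1 - r) *: (affine_path x y t - z) + r *: (affine_path x y t' - z').
  rewrite /affine_path; move: (y - x) => w.
  have -> : (1 - r) * t + r * t' = t + r * (t' - t) by ring.
  have E (a b : V) : (1 - r) *: a + r *: b = a + r *: (b - a).
    by rewrite scalerBl scale1r scalerBr addrAC addrA.
  have subACA (a b c e : V) : (a - b) - (c - e) = (a - c) - (b - e).
    by rewrite !opprD !opprK addrACA.
  rewrite E subACA [x + t' *: w]addrC addrKA -scalerBl; move: (z' - z) => v.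
  by rewrite scalerBr scalerA scalerDl (addrA x) [RHS]addrACA -opprD.
rewrite (le_lt_trans (ler_normD _ _))// !normrZ !ger0_norm ?subr_ge0//.
by apply: convex_combination_lt => //; rewrite r0.
Qed.

Lemma lifting_sub U U' h : open U' -> U' `<=` U -> lifting U h -> lifting U' h.
Proof. by move=> oU' UU' [_ Uh]; split=> // y /UU'/Uh. Qed.

Lemma tube_sub x y p q d p' q' d' : p' <= p -> q <= q' -> d <= d' ->
  tube x y p q d `<=` tube x y p' q' d'.
Proof.
move=> pp' qq' dd' z [t /andP[pt tq] tz]; exists t; last exact: lt_le_trans dd'.
by rewrite (le_trans pp' pt) (le_trans tq qq').
Qed.

Lemma tube_axis x y p q d t : 0 < d -> p <= t <= q ->
  tube x y p q d (affine_path x y t).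
Proof. by move=> d0 ptq; exists t => //; rewrite subrr normr0. Qed.

Lemma segment_closedI A B :
  segment_closed A -> segment_closed B -> segment_closed (A `&` B).
Proof.
by move=> cA cB x y t [Ax Bx] [Ay By] t01; split; [exact: cA|exact: cB].
Qed.

Lemma tube_lifting_local D x y s : locally_liftable D -> D (affine_path x y s) ->
  exists e, 0 < e /\ exists h, lifting (tube x y (s - e) (s + e) e) h.
Proof.
move=> LD /LD[U Us [h Uh]].
have /nbhs_ballP[r /= r0 rU] := open_nbhs_nbhs (conj Uh.1 Us).
have r20 : 0 < r / 2 by rewrite divr_gt0.
have /cvgrPdist_lt/(_ _ r20)/nbhs_ballP[eta /= eta0 etaP] :=
  @affine_path_continuous x y s.
pose e := Num.min (eta / 2) (r / 2).
have e0 : 0 < e by rewrite lt_min !divr_gt0.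
have eeta : e < eta.
  by apply: (@le_lt_trans _ _ (eta / 2)); [rewrite ge_min lexx|lra].
exists e; split=> //; exists h; apply: lifting_sub Uh; first exact: tube_open.
move=> z [t /andP[st ts] tz]; apply: rU; rewrite -ball_normE /=.
rewrite -(subrK (affine_path x y t) (affine_path x y s)) -addrA.
rewrite (le_lt_trans (ler_normD _ _))// (splitr r) ltrD//.
  apply: etaP; rewrite -ball_normE /= (le_lt_trans _ eeta)//.
  by rewrite ler_norml; apply/andP; split; lra.
by apply: lt_le_trans tz _; rewrite ge_min lexx orbT.
Qed.

(** Consider the supremum of all [t] such that some tube around the part [[0, t]] carries a lifting.
    Gluing with a local lifting at the supremum passes beyond it, unless it is 1. *)
Lemma tube_lifting D x y : locally_liftable D ->
  (forall t, 0 <= t <= 1 -> D (affine_path x y t)) ->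
  exists d, 0 < d /\ exists h, lifting (tube x y 0 1 d) h.
Proof.
move=> LD Dxy.
pose S := [set t : R | 0 <= t <= 1 /\
  exists d, 0 < d /\ exists h, lifting (tube x y 0 t d) h].
have S0 : S 0.
  split; first by rewrite lexx ler01.
  have [|e [e0 [h eh]]] := @tube_lifting_local D x y 0 LD.
    by apply: Dxy; rewrite lexx ler01.
  exists e; split=> //; exists h; apply: lifting_sub eh; first exact: tube_open.
  by apply: tube_sub; rewrite ?lexx//; lra.
have supS : has_sup S by split; [exists 0|exists 1 => t [/andP[]]].
have s0 : 0 <= sup S by apply: ub_le_sup => //; case: supS.
have s1 : sup S <= 1 by apply: ge_sup; [exists 0|move=> t [/andP[]]].
have [e [e0 [h eh]]] := @tube_lifting_local D x y (sup S) LD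
  (Dxy _ (introT andP (conj s0 s1))).
have [t [/andP[t0 t1] [d [d0 [k dk]]]] st] := sup_adherent e0 supS.
have ts : t <= sup S.
  apply: ub_le_sup; [by case: supS|split; first by rewrite t0 t1].
  by exists d; split=> //; exists k.
pose t' := Num.min 1 (sup S + e).
have t't : t <= t' by rewrite le_min t1; lra.
have St' : S t'.
  split; first by rewrite (le_trans t0 t't) ge_min lexx.
  pose r := Num.min d e.
  have r0 : 0 < r by rewrite lt_min d0.
  have Lk : lifting (tube x y 0 t r) k.
    apply: lifting_sub dk; first exact: tube_open.
    by apply: tube_sub; rewrite ?lexx ?ge_min ?lexx.
  have Lh : lifting (tube x y t t' r) h.
    apply: lifting_sub eh; first exact: tube_open.
    by apply: tube_sub; rewrite ?ge_min ?lexx ?orbT// ltW.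
  exists r; split=> //; have [||g Lg] := lifting_glue Lk Lh.
  - apply: segment_closed_connected.
    by apply: segment_closedI; exact: tube_segment_closed.
  - by exists (affine_path x y t); split; apply: tube_axis; rewrite ?lexx ?t0.
  exists g; apply: lifting_sub Lg; first exact: tube_open.
  move=> z [u /andP[u0 ut'] uz].
  by have [ut|tu] := leP u t; [left|right]; exists u => //; apply/andP; split=> //;
    exact: ltW.
have : t' <= sup S by apply: ub_le_sup => //; case: supS.
rewrite ge_min orbC => /orP[|s1']; first by move=> ?; lra.
have E : t' = 1 by apply/le_anti; rewrite ge_min lexx /= le_min lexx; lra.
by case: St' => _; rewrite E.
Qed.

(* The lifting at x is carried along the segment from e to x; tubes around
   segments from e are convex, so nearby choices agree on the overlap. *)
Lemma star_lifting D e : open D -> D e -> locally_liftable D ->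
  (forall x t, D x -> 0 <= t <= 1 -> D (affine_path e x t)) ->
  exists h, lifting D h.
Proof.
move=> oD De LD star.
have [s Ts] : exists s, T e s.
  by have [U Ue [h [_ /(_ _ Ue)[? _]]]] := LD e De; exists (h e).
(* All these liftings take the same value [s] at [e], so their differences vanish there. *)
have [F FP] : exists F : V -> R * (V -> R), forall x, D x ->
    [/\ 0 < (F x).1, lifting (tube e x 0 1 (F x).1) (F x).2 & (F x).2 e = s].
  suff /choice[F FP] : forall x, exists p : R * (V -> R), D x ->
      [/\ 0 < p.1, lifting (tube e x 0 1 p.1) p.2 & p.2 e = s] by exists F.
  move=> x; have [Dx|nDx] := pselect (D x); last by exists (0, fun=> 0) => /nDx.
  have [|d [d0 [h Lh]]] := @tube_lifting D e x LD; first by move=> t; exact: star.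
  have te : tube e x 0 1 d e.
    rewrite -[X in tube _ _ _ _ _ X](addr0 e) -(scale0r (x - e)).
    by apply: tube_axis => //; rewrite lexx ler01.
  exists (d, fun z => h z + (s - h e)) => _; split => //=; last by lra.
  by apply: lifting_shift => //; exact: (Lh.2 _ te).1.
have tube_end x y d : 0 < d -> `|x - y| < d -> tube e x 0 1 d y.
  move=> d0 xy; exists 1; first by rewrite ler01 lexx.
  by rewrite /affine_path scale1r [e + _]addrC subrK.
have tube_start x d : 0 < d -> tube e x 0 1 d e.
  move=> d0; exists 0; first by rewrite ler01 lexx.
  by rewrite /affine_path scale0r addr0 subrr normr0.
exists (fun x => (F x).2 x); split=> // x Dx.
have [d0 [_ Lx] Fe] := FP x Dx.
have [|Tx cx] := Lx x; first by apply: tube_end; rewrite ?subrr ?normr0.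
split=> //; apply: (@eq_near_continuous (F x).2 _ x (D `&` ball x (F x).1)) => //.
- by apply: openI => //; exact: ball_open.
- by split=> //; exact: ballxx.
move=> y [Dy]; rewrite -ball_normE /= => xy.
have [d0' Ly Fe'] := FP y Dy.
have Lxy := @lifting_sub_cst _ _ (tube e x 0 1 (F x).1 `&` tube e y 0 1 (F y).1)
  _ _ (conj (tube_open _ _ _ _ _) Lx) Ly.
suff : (F y).2 e - (F x).2 e = (F y).2 y - (F x).2 y by rewrite Fe Fe'; lra.
apply: Lxy => //; last 2 first.
- by split; exact: tube_start.
- by split; apply: tube_end; rewrite ?subrr ?normr0.
apply: segment_closed_connected.
by apply: segment_closedI; exact: tube_segment_closed.
Qed.

End Liftings.

(** * Local inversion *)

Section RowVectors.
Variable R : realType.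

Lemma coord_le_norm n (v : 'rV[R]_n) j : `|v 0 j| <= `|v|.
Proof.
rewrite [leRHS]/Num.Def.normr /= mx_normrE; apply/bigmax_geP; right => /=.
by exists (0, j).
Qed.

Lemma norm_rV_le n (v : 'rV[R]_n) e : 0 <= e -> (forall j, `|v 0 j| <= e) -> `|v| <= e.
Proof.
move=> e0 ve; rewrite [leLHS]/Num.Def.normr /= mx_normrE (bigmax_le _ e0)//= => -[i j] _.
by rewrite (ord1 i).
Qed.

(** The bound is kept at least 1 so that it can be inverted later. *)
Lemma mulmx_bounded n m (A : 'M[R]_(n, m)) :
  exists2 K, 1 <= K & forall v : 'rV_n, `|v *m A| <= K * `|v|.
Proof.
pose K := 1 + \sum_i \sum_j `|A i j|.
have S0 : 0 <= \sum_i \sum_j `|A i j| by do 2 (apply: sumr_ge0 => ? _).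
exists K => [|v]; first by rewrite /K; lra.
apply: norm_rV_le => [|j]; first by rewrite mulr_ge0// /K; lra.
rewrite mxE (le_trans (ler_norm_sum _ _ _))//.
have -> : K * `|v| = `|v| + \sum_i `|v| * \sum_j `|A i j|.
  by rewrite -mulr_sumr /K mulrDl mul1r [_ * `|v|]mulrC.
rewrite -[leLHS]add0r lerD// ler_sum// => i _.
rewrite normrM ler_pM// ?coord_le_norm//.
by rewrite (bigD1 j)//= lerDl sumr_ge0.
Qed.

(** By the reverse triangle inequality, [F] is injective on the ball, with inverse of Lipschitz
    constant 2. *)
Lemma perturbed_id_expanding n (F : 'rV[R]_n -> 'rV[R]_n) (r : R) :
  (forall z z', `|z| < r -> `|z'| < r ->
    `|F z - F z' - (z - z')| <= 2^-1 * `|z - z'|) ->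
  forall z z', `|z| < r -> `|z'| < r -> `|z - z'| <= 2 * `|F z - F z'|.
Proof.
move=> HF z z' zr z'r; have := HF z z' zr z'r.
have := lerB_dist (z - z') (F z - F z'); rewrite [`|z - z' - _|]distrC.
by lra.
Qed.

(** Minimize the distance from [F z] to [y] over a compact ball. At a minimizer, moving by the error
    [u = y - F z] would at least halve the distance, so [u = 0]. *)
Lemma perturbed_id_open n (F : 'rV[R]_n -> 'rV[R]_n) (r : R) : 0 < r ->
  (forall z z', `|z| < r -> `|z'| < r ->
    `|F z - F z' - (z - z')| <= 2^-1 * `|z - z'|) ->
  forall y, `|y - F 0| < r / 10 -> exists2 z, `|z| < r & F z = y.
Proof.
move=> r0 HF y yF; have HE := perturbed_id_expanding HF.
have F0r : `|0 : 'rV[R]_n| < r by rewrite normr0.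
pose A := [set z : 'rV[R]_n | `|z| <= r / 2].
have Ar z : A z -> `|z| < r by rewrite /A /= => ?; lra.
have AE : A = closed_ball 0 (r / 2).
  rewrite closed_ballE ?divr_gt0//; apply/seteqP; split=> z;
  by rewrite /A /closed_ball_ /= sub0r normrN.
have cA : compact A.
  apply: bounded_closed_compact; last by rewrite AE; exact: closed_ball_closed.
  exists (r / 2); split; first exact: num_real.
  by move=> M rM z Az; exact: (le_trans Az (ltW rM)).
have cF : {within A, continuous (fun z => `|F z - y|)}.
  apply: continuous_in_subspaceT => z /set_mem Az.
  suff cFz : F x @[x --> z] --> F z.
    have := cvg_norm (cvgB cFz (cvg_cst y)); exact.
  apply/(@cvgrPdist_lt _ _ _ (nbhs z)) => e e0; near=> t.
  have tr : `|t| < r by near: t; apply: cvgr_norm_lt (Ar _ Az); exact: cvg_id.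
  have zt : `|z - t| < e / 2 by near: t; apply: cvgr_dist_lt; rewrite ?divr_gt0.
  have := HF z t (Ar _ Az) tr; have := @ler_normD _ _ (F z - F t - (z - t)) (z - t).
  by rewrite subrK; lra.
have A0 : A 0 by rewrite /A /= normr0; lra.
have [z /set_mem Az zmin] := EVT_min_rV (ex_intro _ 0 A0) cA cF.
have zr := Ar _ Az.
exists z => //; pose u := y - F z.
have u_le : `|u| <= `|y - F 0|.
  by have := zmin 0 (mem_set A0); rewrite /u ![`|y - _|]distrC.
(* The radius [r / 10] is chosen so that [|z| <= 4 * (r / 10)] and [|u| <= r / 10] keep [z + u] in
   the ball of radius [r / 2]. *)
have zs : `|z| <= 4 * `|y - F 0|.
  have := HE z 0 zr F0r; rewrite subr0.
  have := ler_normD (F z - y) (y - F 0); rewrite addrA subrK.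
  by move: u_le; rewrite /u [`|y - F z|]distrC; lra.
have Azu : A (z + u) by rewrite /A /=; have := ler_normD z u; lra.
have := HF (z + u) z (Ar _ Azu) zr; rewrite (addrC z u) addrK (addrC u z).
have -> : F (z + u) - F z - u = F (z + u) - y by rewrite /u opprB addrA subrK.
have := zmin _ (mem_set Azu); rewrite [`|F z - y|]distrC -/u => h1 h2.
have /normr0_eq0/eqP : `|u| = 0 by have := normr_ge0 u; lra.
by rewrite subr_eq0 => /eqP.
Unshelve. all: end_near. Qed.

Lemma ball_normP n (w x : 'rV[R]_n) r : ball w r x <-> `|w - x| < r.
Proof. by rewrite -ball_normE. Qed.

Lemma ball_segment_closed n (w : 'rV[R]_n) r : segment_closed (ball w r).
Proof.
move=> x y t /ball_normP wx /ball_normP wy /andP[t0 t1]; apply/ball_normP.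
rewrite /affine_path.
have -> : w - (x + t *: (y - x)) = (1 - t) *: (w - x) + t *: (w - y).
  have -> : y - x = (w - x) - (w - y) by rewrite opprB [RHS]addrC subrKA.
  move: (w - y) => B; rewrite opprD addrA; move: (w - x) => A.
  by rewrite scalerBl scale1r scalerBr opprB addrA addrAC.
rewrite (le_lt_trans (ler_normD _ _))// !normrZ !ger0_norm ?subr_ge0//.
by apply: convex_combination_lt => //; rewrite t0.
Qed.

Lemma linear_rV_sum d n (L : {linear 'rV[R]_d -> 'rV[R]_n}) v :
  L v = \sum_j v 0 j *: L 'e_j.
Proof.
rewrite [in LHS](row_sum_delta v) linear_sum.
by apply: eq_bigr => j _; rewrite linearZ.
Qed.

Lemma linear_rV_dist d n (L L' : {linear 'rV[R]_d -> 'rV[R]_n}) e v : 0 <= e ->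
  (forall j, `|L 'e_j - L' 'e_j| <= e) -> `|L v - L' v| <= d%:R * e * `|v|.
Proof.
move=> e0 LL'; rewrite (linear_rV_sum L) (linear_rV_sum L') -sumrB.
rewrite (le_trans (ler_norm_sum _ _ _))//.
have -> : d%:R * e * `|v| = \sum_(j < d) `|v| * e.
  by rewrite sumr_const card_ord -mulr_natr; ring.
by apply: ler_sum => j _; rewrite -scalerBr normrZ ler_pM ?coord_le_norm.
Qed.

(** The mean value theorem is applied on the segment from [w'] to [w], one coordinate at a time;
    this suffices for the sup norm. *)
Lemma C1_strictly_differentiable d n (f : 'rV[R]_d -> 'rV[R]_n)
    (W : set 'rV[R]_d) (w0 : 'rV[R]_d) (e : R) :
  open W -> W w0 -> Ck_on 1 W f -> 0 < e ->
  exists2 r, 0 < r & ball w0 r `<=` W /\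
    forall w w', ball w0 r w -> ball w0 r w' ->
      `|f w - f w' - 'd f w0 (w - w')| <= e * `|w - w'|.
Proof.
move=> oW Ww0 [df cdf] e0.
(* Passing from basis vectors to all vectors costs a factor [d]; dividing by [d.+1] is safe also
   when [d = 0]. *)
pose e' := e / d.+1%:R.
have e'0 : 0 < e' by rewrite divr_gt0.
have : \forall w \near w0, W w /\
    forall j : 'I_d, `|'d f w0 'e_j - 'd f w 'e_j| < e'.
  apply: filterI; first exact: open_nbhs_nbhs.
  apply: (@filter_forall _ _ (fun j w => `|'d f w0 'e_j - 'd f w 'e_j| < e')
    (nbhs w0)) => j.
  have c : {for w0, continuous (fun w => 'd f w 'e_j)} := cdf _ _ Ww0.
  by move/(@cvgrPdist_lt _ _ _ (nbhs w0)): c => /(_ _ e'0).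
move=> /nbhs_ballP[r /= r0 rP]; exists r => //; split=> [w /rP[]//|w w' rw rw'].
have dd x v : ball w0 r x -> `|'d f x v - 'd f w0 v| <= e * `|v|.
  move=> /rP[_ xj].
  have xj' j : `|'d f x 'e_j - 'd f w0 'e_j| <= e' by rewrite distrC ltW.
  apply: le_trans (linear_rV_dist v (ltW e'0) xj') _.
  rewrite ler_wpM2r// /e' mulrA ler_pdivrMr// [leLHS]mulrC.
  by rewrite ler_wpM2l ?ler_nat// ltW.
apply: norm_rV_le => [|j]; first by rewrite mulr_ge0// ltW.
pose v := w - w'; pose x (t : R) := w' + t *: v.
have rx t : 0 <= t <= 1 -> ball w0 r (x t) by move=> t01; exact: ball_segment_closed.
pose phi (t : R) : R := f (x t) 0 j.
pose dphi (t : R) : R := 'd f (x t) v 0 j.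
have phi' (t : R) : 0 <= t <= 1 -> is_derive t (1 : R) phi (dphi t).
  move=> t01.
  have df_xt : differentiable f (x t) by apply/df/(rP _ _).1/rx.
  have dfx : derivable f (x t) v by exact: diff_derivable.
  have E : (fun h : R => h^-1 *: ((phi \o shift t) (h *: (1 : R)) - phi t)) =
      (fun h => h^-1 *: (((fun y => f y 0 j) \o shift (x t)) (h *: v) - f (x t) 0 j)).
    apply/funext => h; rewrite /phi /=.
    have -> : x (h *: (1 : R) + t) = h *: v + x t; last by [].
    by rewrite /x scalerDl addrCA [h *: 1]mulr1.
  have fx' : derivable (fun y => f y 0 j) (x t) v by move/derivable_mxP: dfx; exact.
  split; first by rewrite /derivable E.
  rewrite /derive E -/(derive (fun y => f y 0 j) (x t) v) /dphi.
  by rewrite -deriveE// derive_mx// mxE.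
have [t||t] := @MVT_segment R phi dphi 0 1 ler01.
- by rewrite in_itv /= => /andP[t0 t1]; apply: phi'; rewrite !ltW.
- apply: continuous_in_subspaceT => t; rewrite inE /= in_itv /= => t01.
  have [? _] := phi' t t01.
  by apply/differentiable_continuous/derivable1_diffP.
rewrite in_itv /= subr0 mulr1 => t01.
rewrite /phi /dphi /x scale1r scale0r addr0 [w' + _]addrC subrK => E.
have := le_trans (coord_le_norm _ j) (dd (x t) v (rx _ t01)).
by rewrite !mxE E.
Qed.

End RowVectors.

(** * Immersed hypersurfaces transversal to the radial direction *)

Section Charts.
Variables (R : realType) (n : nat) (M : immersed_submanifold R n).
Local Notation iota := (@im_incl R n M).
Local Notation d := (im_dim M).
Implicit Types (W : set 'rV[R]_d) (g : 'rV[R]_d -> im_space M) (w : 'rV[R]_d).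

Lemma parametrization_strictly_differentiable W g w e :
  local_parametrization iota W g -> W w -> 0 < e ->
  exists2 r, 0 < r & ball w r `<=` W /\
    forall x y, ball w r x -> ball w r y ->
      `|(iota \o g) x - (iota \o g) y - 'd (iota \o g) w (x - y)|
        <= e * `|x - y|.
Proof.
move=> [oW _ _ _ [/(_ 1%N) C1 _]] Ww e0.
exact: (C1_strictly_differentiable oW Ww C1 e0).
Qed.

Lemma parametrization_free W g w : local_parametrization iota W g -> W w ->
  row_free (lin1_mx ('d (iota \o g) w)).
Proof.
move=> [_ _ _ _ [_ /(_ w) inj]] Ww; apply: inj_row_free => v.
by rewrite mul_rV_lin1 => dv; apply: (inj Ww); rewrite dv linear0.
Qed.

Lemma nbhs_parametrization W g w : local_parametrization iota W g -> W w ->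
  forall r, 0 < r -> ball w r `<=` W -> open (g @` ball w r) /\ (g @` ball w r) (g w).
Proof.
move=> [_ _ _ og _] Ww r r0 rW; split; first by apply: og => //; exact: ball_open.
by exists w => //; exact: ballxx.
Qed.

(* The tangent space does not depend on the chart: a curve t |-> g' (w' + t v)
   lifts to the chart g with speed O(t), because 'd (iota \o g) w is injective;
   so its velocity is killed by C as soon as the image of this differential is. *)
Lemma tangent_annihilator W g w (C : 'M[R]_n) u :
  local_parametrization iota W g -> W w ->
  lin1_mx ('d (iota \o g) w) *m C = 0 -> tangent_space (g w) u -> u *m C = 0.
Proof.
move=> P Ww JC [W' [g' [w' [v [P' Ww' gw' ->]]]]].
set f := iota \o g in JC *; set f' := iota \o g'; set u0 := 'd f' w' v.
set J := lin1_mx ('d f w) in JC.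
have [K1 K1_ge1 PK] := mulmx_bounded (pinvmx J).
have [K2 K2_ge1 CK] := mulmx_bounded C.
(* [H4] and [H5] yield the first term of [N], and [H6] the second, each with a factor [e * t]. *)
pose N := 2 * K1 * K2 * (`|u0| + `|v|) + K2 * `|v|.
have N0 : 0 <= N.
  by rewrite /N !(addr_ge0, mulr_ge0, normr_ge0)//; lra.
suff H e : 0 < e -> e <= (2 * K1)^-1 -> `|u0 *m C| <= e * N.
  apply/eqP; rewrite -normr_le0; apply/ler_addgt0Pl => e e0.
  pose e' := Num.min (e / (1 + N)) (2 * K1)^-1.
  have e'0 : 0 < e' by rewrite lt_min divr_gt0 ?invr_gt0//; lra.
  have := H e' e'0; rewrite addr0 => /(_ _)/le_trans; apply.
    by rewrite ge_min lexx orbT.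
  have : e' <= e / (1 + N) by rewrite ge_min lexx.
  by rewrite ler_pdivlMr; [nra|lra].
move=> e0 eK1.
have eK : e * K1 <= 2^-1.
  have : e * (2 * K1) <= 1 by rewrite -ler_pdivlMr ?mul1r//; lra.
  by lra.
have e1 : e <= 1 by nra.
have [r r0 [rW rf]] := parametrization_strictly_differentiable P Ww e0.
have [r' r'0 [rW' rf']] := parametrization_strictly_differentiable P' Ww' e0.
have [oB Bm] := nbhs_parametrization P Ww r0 rW.
have [s /= s0 sB] : nbhs_ball w' (g' @^-1` (g @` ball w r)).
  apply/nbhs_ballP; have [_ _ cg' _ _] := P'.
  by apply: (cg' w' Ww'); apply: open_nbhs_nbhs; rewrite gw'.
(* [t] is small enough for [w' + t *: v] to stay in the balls of radii [s] and [r'] around [w']. *)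
pose t := Num.min s r' / (2 * (`|v| + 1)).
have v0 := normr_ge0 v.
have m0 : 0 < Num.min s r' by rewrite lt_min s0.
have t0 : 0 < t by rewrite divr_gt0//; lra.
have tv : t * `|v| < Num.min s r'.
  rewrite /t mulrAC ltr_pdivrMr; last lra.
  by rewrite ltr_pM2l//; lra.
have dist_tv : `|w' - (w' + t *: v)| = t * `|v|.
  by rewrite opprD addrA subrr sub0r normrN normrZ gtr0_norm.
have [wt rwt gwt] : (g @` ball w r) (g' (w' + t *: v)).
  by apply: sB; apply/ball_normP; rewrite dist_tv (lt_le_trans tv)// ge_min lexx.
have rwt' : ball w' r' (w' + t *: v).
  by apply/ball_normP; rewrite dist_tv (lt_le_trans tv)// ge_min lexx orbT.
pose q := f' (w' + t *: v) - f' w'.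
have qE : q = f wt - f w by rewrite /q /f /f' /= gwt gw'.
have H1 : `|q - t *: u0| <= e * (t * `|v|).
  have := rf' _ _ rwt' (ballxx _ r'0).
  have -> : w' + t *: v - w' = t *: v by rewrite addrC addKr.
  have -> : 'd (iota \o g') w' (t *: v) = t *: u0 by exact: linearZ.
  by rewrite normrZ (gtr0_norm t0).
have H2 : `|q - (wt - w) *m J| <= e * `|wt - w|.
  by rewrite /J mul_rV_lin1 qE; apply: rf => //; exact: ballxx.
(* The right inverse [pinvmx J] recovers [wt - w] with bound [K1], and [e * K1 <= 2^-1] absorbs the
   linearization error. *)
have H3 : `|wt - w| <= 2 * K1 * `|q|.
  have : `|wt - w| <= K1 * `|(wt - w) *m J|.
    by rewrite -[in leLHS](mulmx1 (wt - w)) -(mulmxVp (parametrization_free P Ww)) mulmxA.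
  have := ler_normB q (q - (wt - w) *m J); rewrite opprB addrC subrK.
  have := normr_ge0 (wt - w).
  move: (`|wt - w|) (`|_ *m J|) (`|q|) (`|_ - _|) H2 => A B Q D; nra.
have H4 : `|q *m C| <= e * (2 * K1 * K2 * `|q|).
  have -> : q *m C = (q - (wt - w) *m J) *m C.
    by rewrite (mulmxBl q) -mulmxA JC mulmx0 subr0.
  apply: le_trans (CK _) _.
  have -> : e * (2 * K1 * K2 * `|q|) = K2 * (e * (2 * K1 * `|q|)) by ring.
  apply: ler_wpM2l; first lra.
  by apply: le_trans H2 _; apply: ler_wpM2l => //; lra.
have H5 : `|q| <= t * (`|u0| + `|v|).
  have := ler_normD (q - t *: u0) (t *: u0); rewrite subrK normrZ (gtr0_norm t0).
  have : e * (t * `|v|) <= t * `|v| by rewrite ler_piMl// mulr_ge0// ltW.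
  by lra.
have H6 : `|(q - t *: u0) *m C| <= e * (t * (K2 * `|v|)).
  apply: le_trans (CK _) _.
  have -> : e * (t * (K2 * `|v|)) = K2 * (e * (t * `|v|)) by ring.
  by apply: ler_wpM2l => //; lra.
have : t * `|u0 *m C| <= `|q *m C| + `|(q - t *: u0) *m C|.
  have := ler_normB (q *m C) ((q - t *: u0) *m C).
  by rewrite -mulmxBl opprB addrC subrK -scalemxAl normrZ (gtr0_norm t0).
have : e * (2 * K1 * K2 * `|q|) <= e * (2 * K1 * K2 * (t * (`|u0| + `|v|))).
  apply: ler_wpM2l; first lra.
  by apply: ler_wpM2l => //; rewrite !mulr_ge0//; lra.
move=> H7 H8; suff : t * `|u0 *m C| <= t * (e * N) by rewrite ler_pM2l.
have -> : t * (e * N) = t * (e * (2 * K1 * K2 * (`|u0| + `|v|) + K2 * `|v|)) by [].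
have -> : t * (e * (2 * K1 * K2 * (`|u0| + `|v|) + K2 * `|v|)) =
  e * (2 * K1 * K2 * (t * (`|u0| + `|v|))) + e * (t * (K2 * `|v|)) by ring.
by lra.
Qed.

(** * Radial coordinates near a point of a transversal hypersurface *)

Definition radially_transversal (m : im_space M) :=
  forall v, exists t r, tangent_space m t /\ v = t + r *: iota m.

(** The cokernel of the stacked matrix kills the tangent space and the radial vector, hence by
    transversality everything. *)
Lemma transversal_full W g w : local_parametrization iota W g -> W w ->
  radially_transversal (g w) ->
  row_full (col_mx (lin1_mx ('d (iota \o g) w)) (iota (g w))).
Proof.
move=> P Ww tr; set J := lin1_mx _; set B := col_mx _ _.
have /eqP := mulmx_coker B; rewrite mul_col_mx col_mx_eq0 => /andP[/eqP JC /eqP xC].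
rewrite -sub1mx submxE mul1mx; apply/eqP/row_matrixP => i; rewrite rowE row0.
have [t [s [Tt ->]]] := tr 'e_i.
by rewrite mulmxDl -scalemxAl xC scaler0 addr0 (tangent_annihilator P Ww JC Tt).
Qed.

(* In the linear coordinates z |-> (z *m N1, z *m N2) on R^d x R, inverse to the
   differential at (w, 1) of the map (v, l) |-> l *: iota (g v), this map is close
   to the identity. *)
Lemma radial_perturbed_id W g w : local_parametrization iota W g -> W w ->
  d.+1 = n -> radially_transversal (g w) ->
  exists (N1 : 'M[R]_(n, d)) (N2 : 'M[R]_(n, 1)) (J : 'M[R]_(d, n)) (r : R),
  let x := iota (g w) in
  let F z := (1 + (z *m N2) 0 0) *: iota (g (w + z *m N1)) in
  [/\ J *m N1 = 1%:M, J *m N2 = 0, x *m N1 = 0 & x *m N2 = 1%:M] /\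
  [/\ 0 < r,
      forall z, `|z| < r -> W (w + z *m N1) /\ 0 < 1 + (z *m N2) 0 0 &
      forall z z', `|z| < r -> `|z'| < r ->
        `|F z - F z' - (z - z')| <= 2^-1 * `|z - z'|].
Proof.
move=> P Ww dn tr; set f := iota \o g; set x := iota (g w).
set J := lin1_mx ('d f w); set B := col_mx J x.
have fullB : row_full B := transversal_full P Ww tr.
(* Since [d.+1 = n], the matrix [B] is square, and [pinvmx B] is a two-sided inverse. *)
have freeB : row_free B.
  by move: fullB; rewrite /row_free /row_full => /eqP ->; rewrite addn1 dn.
set N := pinvmx B; pose N1 : 'M[R]_(n, d) := lsubmx N; pose N2 : 'M[R]_(n, 1) := rsubmx N.
have NE : N = row_mx N1 N2 by rewrite hsubmxK.
pose l (z : 'rV[R]_n) := (z *m N2) 0 0.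
have zE z : z = z *m N1 *m J + l z *: x.
  rewrite -[LHS]mulmx1 -(mulVpmx fullB) -/N NE mul_row_col mulmxDr !mulmxA.
  by rewrite {1}(mx11_scalar (z *m N2)) mul_scalar_mx.
have lB z z' : l (z - z') = l z - l z' by rewrite /l mulmxBl !mxE.
have [K1 K1_ge1 bN1] := mulmx_bounded N1.
have [K2 K2_ge1 bN2] := mulmx_bounded N2.
have [K3 K3_ge1 bJ] := mulmx_bounded J.
pose K := K1 + K2 + K3.
have K_ge1 : 1 <= K by rewrite /K; lra.
have K0 : 0 < K by lra.
have bN1K (z : 'rV[R]_n) : `|z *m N1| <= K * `|z|.
  by apply: le_trans (bN1 z) _; rewrite ler_wpM2r// /K; lra.
have blK z : `|l z| <= K * `|z|.
  apply: le_trans (coord_le_norm _ _) _; apply: le_trans (bN2 z) _.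
  by rewrite ler_wpM2r// /K; lra.
have bJK (v : 'rV[R]_d) : `|v *m J| <= K * `|v|.
  by apply: le_trans (bJ v) _; rewrite ler_wpM2r// /K; lra.
(* The choices of [e] and [r] bound the error terms [T1], [T2], [T3] by 13/144, 1/12 and 1/6 of
   [|z - z'|], together less than 1/2. *)
pose e := (12 * K)^-1.
have e0 : 0 < e by rewrite invr_gt0; lra.
have eK : e * K = 12^-1 by rewrite /e invfM -mulrA mulVf ?mulr1// gt_eqF.
have e1 : e <= 1 by nra.
have [s s0 [sW sf]] := parametrization_strictly_differentiable P Ww e0.
pose r := Num.min (s / (2 * K)) (12 * K ^+ 3)^-1.
have K30 : 0 < K ^+ 3 by rewrite exprn_gt0.
have K3ge : K <= K ^+ 3 by rewrite ler_eXnr.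
have r0 : 0 < r by rewrite lt_min divr_gt0 ?invr_gt0//; lra.
have Ks : K * r < s.
  have : r <= s / (2 * K) by rewrite ge_min lexx.
  by rewrite ler_pdivlMr; lra.
have K3r : K ^+ 3 * r <= 12^-1.
  have : r <= (12 * K ^+ 3)^-1 by rewrite ge_min lexx orbT.
  by rewrite -[leRHS]div1r ler_pdivlMr; lra.
have ballN (z : 'rV[R]_n) : `|z| < r -> ball w s (w + z *m N1).
  move=> zr; apply/ball_normP; rewrite opprD addrA subrr sub0r normrN.
  apply: le_lt_trans (bN1K z) _; apply: le_lt_trans Ks.
  by rewrite ler_pM2l// ltW.
have lsmall (z : 'rV[R]_n) : `|z| < r -> `|l z| * K ^+ 2 <= 12^-1.
  move=> zr; apply: le_trans K3r.
  have -> : K ^+ 3 * r = (K * r) * K ^+ 2 by ring.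
  rewrite ler_wpM2r ?exprn_ge0 ?(ltW K0)//; apply: le_trans (blK z) _.
  by rewrite ler_pM2l// ltW.
have K2ge1 : 1 <= K ^+ 2 by rewrite exprn_ege1.
have lsmall' (z : 'rV[R]_n) : `|z| < r -> `|l z| <= 12^-1.
  by move=> /lsmall; have := normr_ge0 (l z); nra.
exists N1, N2, J, r => /=; split.
  have := mulmxVp freeB; rewrite -/N NE mul_col_row scalar_mx_block.
  by move=> /eq_block_mx[-> -> -> ->].
split=> // [z zr|z z' zr z'r].
  split; first exact/sW/ballN.
  by have := lsmall' z zr; rewrite -/(l z) ler_norml => /andP[]; lra.
rewrite -/(l z) -/(l z'); set a := w + z *m N1; set a' := w + z' *m N1.
pose D := f a - f a' - (z - z') *m N1 *m J.
pose E := (z - z') *m N1 *m J.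
have aB : a - a' = (z - z') *m N1.
  by rewrite /a /a' opprD addrACA subrr add0r mulmxBl.
have bD : `|D| <= 12^-1 * `|z - z'|.
  have -> : D = f a - f a' - 'd f w (a - a') by rewrite /D /J mul_rV_lin1 aB.
  apply: le_trans (sf _ _ (ballN z zr) (ballN z' z'r)) _.
  rewrite -/a -/a' aB -eK -mulrA ler_wpM2l ?(ltW e0)//; exact: bN1K.
have bE : `|E| <= K ^+ 2 * `|z - z'|.
  apply: le_trans (bJK _) _; have -> : K ^+ 2 * `|z - z'| = K * (K * `|z - z'|) by ring.
  by rewrite ler_pM2l.
have ba' : `|f a' - x| <= 2 * K ^+ 2 * r.
  have H1 : `|f a' - f w - 'd f w (a' - w)| <= e * `|a' - w|.
    by apply: sf; [exact: ballN|exact: ballxx].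
  have a'w : a' - w = z' *m N1 by rewrite /a' addrC addKr.
  have H2 : `|'d f w (a' - w)| <= K * `|a' - w| by rewrite -mul_rV_lin1; exact: bJK.
  have H3 : `|a' - w| <= K * r.
    by rewrite a'w; apply: le_trans (bN1K z') _; rewrite ler_pM2l// ltW.
  have := ler_normD (f a' - f w - 'd f w (a' - w)) ('d f w (a' - w)).
  rewrite subrK.
  have : (e + K) * `|a' - w| <= (2 * K) * (K * r).
    by rewrite ler_pM//; lra.
  by rewrite /x /f /=; lra.
(* The three errors come from the nonlinearity of the chart, the factor [1 + l z] in place of 1, and
   the base point [f a'] in place of [x]. *)
have -> : (1 + l z) *: iota (g a) - (1 + l z') *: iota (g a') - (z - z') =
    (1 + l z) *: D + l z *: E + l (z - z') *: (f a' - x).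
  rewrite {1}(zE (z - z')) -/E /D -/E lB /f /=.
  by apply/rowP => i; rewrite !mxE; ring.
have := lsmall z zr; have := lsmall' z zr.
have := ler_normD ((1 + l z) *: D + l z *: E) (l (z - z') *: (f a' - x)).
have := ler_normD ((1 + l z) *: D) (l z *: E).
rewrite !normrZ.
have T1 : `|1 + l z| * `|D| <= (13 / 12) * (12^-1 * `|z - z'|).
  by rewrite ler_pM//; have := lsmall' z zr; rewrite !ler_norml => /andP[]; lra.
have T2 : `|l z| * `|E| <= 12^-1 * `|z - z'|.
  apply: le_trans (ler_wpM2l (normr_ge0 _) bE) _.
  by rewrite mulrA ler_wpM2r//; exact: lsmall.
have T3 : `|l (z - z')| * `|f a' - x| <= 6^-1 * `|z - z'|.
  apply: le_trans (ler_pM _ _ (blK _) ba') _ => //.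
  have -> : K * `|z - z'| * (2 * K ^+ 2 * r) = 2 * (K ^+ 3 * r) * `|z - z'| by ring.
  by rewrite ler_wpM2r//; lra.
by have := normr_ge0 (z - z'); lra.
Qed.

Lemma im_incl_continuous : continuous iota.
Proof.
move=> m; have [W [g [P [w Ww <-]]]] := im_charts m.
move=> A /= Aw.
have [oW _ _ og [/(_ 0%N) cf _]] := P.
have : nbhs w (((iota \o g) @^-1` A) `&` W).
  by apply: filterI; [exact: cf|exact: open_nbhs_nbhs].
move=> /nbhs_ballP[r /= r0 rA].
have [oB Bm] := nbhs_parametrization P Ww r0 (fun x Bx => (rA x Bx).2).
apply: filterS (open_nbhs_nbhs (conj oB Bm)).
by move=> _ [x /rA[Ax _] <-].
Qed.

(** [F] covers a ball around [iota m], and [rho y] is the radial factor of a preimage of [y]. So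
    dilates of [M] sweep out a neighbourhood, with a continuous factor. *)
Lemma radial_box (m : im_space M) : d.+1 = n -> radially_transversal m ->
  exists (U : set 'rV[R]_n) (rho : 'rV[R]_n -> R), [/\ open U, U (iota m) &
    forall y, U y -> [/\ 0 < rho y, {for y, continuous rho} &
      carrier M ((rho y)^-1 *: y)]].
Proof.
have [W [g [P [w Ww <-]]]] := im_charts m => dn tr.
have [N1 [N2 [J [r /=]]]] := radial_perturbed_id P Ww dn tr.
set x := iota (g w); pose l (z : 'rV[R]_n) := (z *m N2) 0 0.
pose F z := (1 + l z) *: iota (g (w + z *m N1)).
move=> [_ [r0 rW rF]].
have F0 : F 0 = x by rewrite /F /l !mul0mx mxE !addr0 scale1r.
have [zeta zetaP] : exists zeta, forall y : 'rV[R]_n, ball x (r / 10) y ->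
    `|zeta y| < r /\ F (zeta y) = y.
  suff /choice[zeta zetaP] : forall y : 'rV[R]_n, exists z,
      ball x (r / 10) y -> `|z| < r /\ F z = y by exists zeta.
  move=> y; have [/ball_normP xy|nxy] := pselect (ball x (r / 10) y); last first.
    by exists 0 => /nxy.
  have [|z zr Fz] := @perturbed_id_open _ _ F r r0 rF y; last by exists z.
  by rewrite F0 distrC.
have [K K_ge1 bl] := mulmx_bounded N2.
exists (ball x (r / 10)), (fun y => 1 + l (zeta y)); split.
- exact: ball_open.
- by apply: ballxx; rewrite divr_gt0.
move=> y xy; have [zr Fz] := zetaP y xy; have [Wz l0] := rW _ zr.
split=> //; last first.
  exists (g (w + zeta y *m N1)) => //.
  by rewrite -[X in _ = _ *: X]Fz /F scalerA mulVf ?scale1r// gt_eqF.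
apply/(@cvgrPdist_lt _ _ _ (nbhs y)) => e e0.
have k0 : 0 < e / (2 * K) by rewrite divr_gt0//; lra.
near=> y'.
have xy' : ball x (r / 10) y'.
  by near: y'; apply: open_nbhs_nbhs; split => //; exact: ball_open.
have yy' : `|y - y'| < e / (2 * K).
  by apply/ball_normP; near: y'; exact: nbhsx_ballx.
have [zr' Fz'] := zetaP _ xy'.
have lB : 1 + l (zeta y) - (1 + l (zeta y')) = l (zeta y - zeta y').
  by rewrite opprD addrACA subrr add0r /l mulmxBl !mxE.
rewrite lB; apply: le_lt_trans (coord_le_norm _ _) _.
apply: le_lt_trans (bl _) _.
(* The right inverse [zeta] of [F] has Lipschitz constant 2, so [rho] has Lipschitz constant
   [2 * K]. *)
have := perturbed_id_expanding rF zr zr'; rewrite -/(F _) -/(F (zeta y')) Fz Fz'.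
move: yy'; rewrite ltr_pdivlMr; last lra.
by nra.
Unshelve. all: end_near. Qed.

(** [F] is injective near 0. A nearby point of [M] on the line through [iota m] has a preimage [z1]
    along the chart and a preimage [z2] along the line; comparing radial coordinates gives
    [0 = lambda - 1]. *)
Lemma radially_isolated (m : im_space M) : d.+1 = n -> radially_transversal m ->
  exists2 O, open O /\ O m &
    forall m' lambda, O m' -> iota m' = lambda *: iota m -> lambda = 1.
Proof.
have [W [g [P [w Ww <-]]]] := im_charts m => dn tr.
have [N1 [N2 [J [r /=]]]] := radial_perturbed_id P Ww dn tr.
set x := iota (g w); pose l (z : 'rV[R]_n) := (z *m N2) 0 0.
pose F z := (1 + l z) *: iota (g (w + z *m N1)).
move=> [[JN1 JN2 xN1 xN2] [r0 _ rF]].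
have [K K_ge1 bJ] := mulmx_bounded J.
have [oW _ _ _ [/(_ 0%N) cf _]] := P.
have : \forall v \near w, W v /\ `|x - iota (g v)| < r.
  apply: filterI; first exact: open_nbhs_nbhs.
  by move: (cf w Ww) => /(@cvgrPdist_lt _ _ _ (nbhs w))/(_ r r0).
move=> /nbhs_ballP[s /= s0 sP].
have q0 : 0 < Num.min s (r / K) by rewrite lt_min s0 divr_gt0//; lra.
have qs v : ball w (Num.min s (r / K)) v -> W v /\ `|x - iota (g v)| < r.
  by move=> qv; apply: sP; apply: le_ball qv; rewrite ge_min lexx.
exists (g @` ball w (Num.min s (r / K))).
  by apply: (nbhs_parametrization P Ww) => // v /qs[].
move=> _ lambda [v qv <-] xv; have [Wv xvr] := qs v qv.
pose z1 := (v - w) *m J; pose z2 := (lambda - 1) *: x.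
have z1r : `|z1| < r.
  apply: le_lt_trans (bJ _) _.
  move/ball_normP: qv; rewrite lt_min distrC => /andP[_].
  by rewrite ltr_pdivlMr 1?mulrC//; lra.
have z2r : `|z2| < r.
  by move: xvr; rewrite xv -/x distrC /z2 scalerBl scale1r.
have Fz1 : F z1 = iota (g v).
  by rewrite /F /l /z1 -!mulmxA JN1 JN2 mulmx0 mulmx1 mxE addr0 scale1r addrC subrK.
have Fz2 : F z2 = lambda *: x.
  rewrite /F /l /z2 -!scalemxAl xN1 xN2 scaler0 addr0 !mxE eqxx mulr1.
  by rewrite addrC subrK.
have := perturbed_id_expanding rF z1r z2r.
rewrite -/(F z1) -/(F z2) Fz1 Fz2 xv subrr normr0 mulr0 normr_le0 subr_eq0.
move=> /eqP z12; have : l z1 = l z2 by rewrite z12.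
rewrite /l /z1 /z2 -mulmxA JN2 mulmx0 -scalemxAl xN2 !mxE eqxx mulr1.
by move=> /esym/eqP; rewrite subr_eq0 => /eqP.
Qed.

(** Each point of [M] on the ray is isolated by a member of a countable base, and distinct points
    need distinct members. *)
Lemma countable_ray (m : im_space M) : d.+1 = n ->
  (forall m' : im_space M, radially_transversal m') ->
  countable [set s : R | carrier M (expR s *: iota m)].
Proof.
move=> dn tr.
pose S := [set s : R | carrier M (expR s *: iota m)].
have [B cB [_ Bnbhs]] := im_second_countable M.
have /choice[p pP] : forall s, exists p : im_space M * set (im_space M), S s ->
    [/\ iota p.1 = expR s *: iota m, B p.2, p.2 p.1 &
      forall m' lambda, p.2 m' -> iota m' = lambda *: iota p.1 -> lambda = 1].
  move=> s; have [[m' _ m's]|nSs] := pselect (S s); last by by exists (m, set0).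
  have [V [oV Vm'] isoV] := radially_isolated dn (tr m').
  have [U [BU Um'] UO] := Bnbhs m' V (open_nbhs_nbhs (conj oV Vm')).
  by exists (m', U) => _; split => //= m'' l Um''; apply: isoV; exact: UO.
have /countable_injP[f finj] := cB.
apply/countable_injP; exists (fun s => f (p s).2) => s s' /set_mem Ss /set_mem Ss'.
have [ms Bs ps iso] := pP s Ss; have [ms' Bs' ps' _] := pP s' Ss'.
move=> /(finj _ _ (mem_set Bs) (mem_set Bs')) E.
have : expR (s' - s) = 1.
  apply: (iso (p s').1); first by rewrite E.
  by rewrite ms ms' scalerA -expRD subrK.
by rewrite -expR0 => /expR_inj/eqP; rewrite subr_eq0 => /eqP.
Qed.

End Charts.

(** * Slit spaces *)

Section SlitSpaces.
Variables (R : realType) (n : nat).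
Local Notation V := 'rV[R]_n.+2.
Implicit Types (x : V) (s : R) (j : 'I_n.+2).

(* For s = 1 or -1, the complement of the half-axis opposite to s *: 'e_0. *)
Definition slit_space s : set V :=
  [set x | 0 < s * x 0 0 \/ exists2 j, j != 0 & x 0 j != 0].

Definition half_space j s : set V := [set x | 0 < s * x 0 j].

Lemma coord_open j (A : set R) : open A -> open [set x : V | A (x 0 j)].
Proof. by move=> oA; apply: open_comp => // x _; exact: coord_continuous. Qed.

Lemma half_space_open s j : open (half_space j s).
Proof.
apply: (@coord_open j [set y | 0 < s * y]).
apply: (@open_comp _ _ ( *%R s) [set y | 0 < y]) => //.
by move=> y _; exact: mulrl_continuous.
Qed.

Lemma slit_space_open s : open (slit_space s).
Proof.
have -> : slit_space s = half_space 0 s `|`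
    \bigcup_(j in [set j | j != 0]) [set x : V | x 0 j != 0].
  by apply/seteqP; split=> x [?|[j]]; [left|right; exists j|left|right; exists j].
apply: openU; first exact: half_space_open.
apply: bigcup_open => j _; have H : open [set y : R | y != 0] := @open_neq _ 0.
exact: coord_open H.
Qed.

Lemma affine_path_coord x (y : V) t j :
  affine_path x y t 0 j = x 0 j + t * (y 0 j - x 0 j).
Proof. by rewrite /affine_path !mxE. Qed.

Lemma half_space_segment_closed j s : segment_closed (half_space j s).
Proof.
move=> x y t xj yj t01; rewrite /half_space /= affine_path_coord -oppr_lt0.
have -> : - (s * (x 0 j + t * (y 0 j - x 0 j))) =
    (1 - t) * - (s * x 0 j) + t * - (s * y 0 j) by ring.
by apply: convex_combination_lt => //; rewrite oppr_lt0.
Qed.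

(** Off the axis, a nonzero coordinate is multiplied by [t], so it stays nonzero until the path
    reaches the centre. *)
Lemma slit_space_star s x t : s * s = 1 -> slit_space s x -> 0 <= t <= 1 ->
  slit_space s (affine_path (s *: 'e_0) x t).
Proof.
move=> ss xs t01.
have [->|t0] := eqVneq t 0.
  by left; rewrite affine_path_coord mul0r addr0 !mxE eqxx mulr1 ss ltr01.
case: xs => [x0|[j j0 xj]].
  left; apply: half_space_segment_closed => //.
  by rewrite /half_space /= !mxE eqxx mulr1 ss ltr01.
right; exists j => //.
by rewrite affine_path_coord !mxE (negPf j0) mulr0 subr0 add0r mulf_neq0.
Qed.

Lemma slit_spaceI x : slit_space 1 x -> slit_space (-1) x ->
  exists2 j, j != 0 & x 0 j != 0.
Proof. by move=> [x0|//] [x0'|//]; lra. Qed.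

Lemma half_space_sub j s : j != 0 ->
  half_space j s `<=` slit_space 1 `&` slit_space (-1).
Proof.
move=> j0 x xj; have xj0 : x 0 j != 0.
  by apply: contraTneq xj => E; rewrite /half_space /= E mulr0 ltxx.
by split; right; exists j.
Qed.

Lemma slit_space_cover x : x != 0 -> slit_space 1 x \/ slit_space (-1) x.
Proof.
move=> /rV0Pn[j xj]; have [j0|j0] := eqVneq j 0; last by left; right; exists j.
move: xj; rewrite j0 neq_lt => /orP[x0|x0]; [right|left]; left; lra.
Qed.

Variables (T : V -> set R) (G : set R).
Hypotheses (Gcount : countable G)
  (TG : forall y s s', T y s -> T y s' <-> G (s' - s)).

Lemma slit_space_lifting s : s * s = 1 ->
  locally_liftable T [set x : V | x != 0] ->
  exists h, lifting T (slit_space s) h.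
Proof.
move=> ss LX; apply: (star_lifting Gcount TG (e := s *: 'e_0)).
- exact: slit_space_open.
- by left; rewrite !mxE eqxx mulr1 ss ltr01.
- move=> x xs; apply: LX; apply/eqP => x0; case: xs => [|[j _]];
  by rewrite x0 mxE ?mulr0 ?ltxx ?eqxx.
- by move=> x t; exact: slit_space_star.
Qed.

(** The overlap is the complement of the first axis. It is covered by the half-spaces [x_j > 0] and
    [x_j < 0] with [j != 0], and [h' - h] is constant on each. All of them except [x_j1 < 0] meet
    [x_j1 > 0]. *)
Lemma slit_space_liftings : locally_liftable T [set x : V | x != 0] ->
  exists a h h', [/\ lifting T (slit_space 1) h, lifting T (slit_space (-1)) h' &
    forall x, slit_space 1 x -> slit_space (-1) x ->
      h' x = h x \/ h' x = h x + a].
Proof.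
move=> LX.
have [h Lh] : exists h, lifting T (slit_space 1) h.
  by apply: slit_space_lifting => //; rewrite mulr1.
have [k Lk] : exists h, lifting T (slit_space (-1)) h.
  by apply: slit_space_lifting => //; rewrite mulrNN mulr1.
(* A second coordinate exists because the dimension is at least 2. *)
pose j1 : 'I_n.+2 := lift ord0 ord0.
have j10 : j1 != 0 by [].
pose p : V := 'e_j1.
have pC : half_space j1 1 p by rewrite /half_space /= mxE eqxx mulr1 ltr01.
have [p1 p2] := half_space_sub j10 pC.
(* This shift makes [h'] agree with [h] at [p], hence on [x_j1 > 0]. *)
pose h' x := k x + (h p - k p).
have Lh' : lifting T (slit_space (-1)) h'.
  by apply: (lifting_shift TG) => //; [exact: (Lk.2 p p2).1|exact: (Lh.2 p p1).1].
have cst j s x y : j != 0 -> half_space j s x -> half_space j s y ->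
    h' x - h x = h' y - h y.
  move=> j0; apply: (lifting_sub_cst Gcount TG Lh Lh').
    exact/segment_closed_connected/half_space_segment_closed.
  exact: half_space_sub.
have h'p : h' p - h p = 0 by rewrite /h'; lra.
pose a := h' (- p) - h (- p).
exists a, h, h'; split => // x x1 x2.
have [j j0 xj] := slit_spaceI x1 x2.
have [jj1|jj1] := eqVneq j j1.
  move: xj; rewrite jj1 neq_lt => /orP[xj|xj].
    right; have : h' x - h x = a; last by lra.
    apply: (cst j1 (-1)) => //; first by rewrite /half_space /=; lra.
    by rewrite /half_space /= !mxE !eqxx /= mulrNN mulr1 ltr01.
  left; have : h' x - h x = h' p - h p; last by lra.
  by apply: (cst j1 1) => //; rewrite /half_space /= mul1r.
left; pose s := Num.sg (x 0 j).
(* [q] lies both in the half-space of [x] and in [x_j1 > 0]. *)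
pose q : V := s *: 'e_j + 'e_j1.
have : h' x - h x = h' q - h q.
  apply: (cst j s) => //; rewrite /half_space /=.
    by rewrite /s -normrEsg normr_gt0.
  rewrite !mxE !eqxx (negPf jj1) addr0 mulr1 -expr2 sqr_sg xj.
  exact: ltr01.
have : h' q - h q = h' p - h p; last by lra.
apply: (cst j1 1) => //; rewrite /half_space /= !mxE !eqxx [j1 == j]eq_sym (negPf jj1).
by rewrite mulr0 add0r mulr1 ltr01.
Qed.

End SlitSpaces.

(** * A periodic function of the liftings and the contradiction with density *)

Lemma exists_periodic (R : realType) (a : R) : exists k : R -> R,
  [/\ continuous k, forall u, k (u + a) = k u & forall c, ~ forall u, k u = c].
Proof.
(* Period 0 is no constraint, so the identity serves. *)
have [->|a0] := eqVneq a 0.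
  exists id; split=> [u|u|c kc]; [exact: cvg_id|by rewrite addr0|].
  by have := kc (c + 1); lra.
exists (fun u => cos (u / a * (pi *+ 2))); split=> [u|u|c kc].
- apply: continuous_comp; last exact: continuous_cos.
  apply: cvgMl; apply: cvgMl; exact: cvg_id.
- by rewrite mulrDl divff// mulrDl mul1r cosD cos2pi sin2pi mulr1 mulr0 subr0.
have := kc 0; have := kc (a / 2); rewrite mul0r mul0r cos0.
have -> : a / 2 / a * (pi *+ 2) = pi by rewrite -mulr_natr; field.
by rewrite cospi; lra.
Qed.

Section DenseRange.
Variables (R : realType) (n : nat).
Local Notation V := 'rV[R]_n.+2.
Variables (T : V -> set R) (G : set R) (M : topologicalType) (i : M -> V).
Hypotheses (Gcount : countable G)
  (TG : forall y s s', T y s -> T y s' <-> G (s' - s))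
  (Tscale : forall y s u, T y s -> T (expR u *: y) (s + u))
  (LX : locally_liftable T [set x : V | x != 0])
  (ci : continuous i) (Mconn : connected [set: M])
  (iM : forall m, T (i m) 0) (i0 : forall m, i m != 0).

Lemma range_not_dense : ~ ([set x | x != 0] `<=` closure (range i)).
Proof.
move=> dense.
have [a [h [h' [Lh Lh' hh']]]] := slit_space_liftings Gcount TG LX.
have [k [ck ka knc]] := exists_periodic a.
(* [k] does not see the discrepancy [a], so [k \o h] and [k \o h'] glue to a function [f] continuous
   away from 0. *)
have kk' x : slit_space 1 x -> slit_space (-1) x -> k (h' x) = k (h x).
  by move=> x1 x2; have [->|->] := hh' x x1 x2; rewrite ?ka.
pose f x := if x \in slit_space 1 then k (h x) else k (h' x).
have f1 x : slit_space 1 x -> f x = k (h x) by move=> x1; rewrite /f mem_set.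
have f2 x : slit_space (-1) x -> f x = k (h' x).
  by move=> x2; rewrite /f; case: ifPn => // /set_mem x1; rewrite kk'.
have cf x : x != 0 -> {for x, continuous f}.
  case/slit_space_cover => xs.
    apply: (@eq_near_continuous _ _ (k \o h) f x (slit_space 1)) => //.
    - exact: slit_space_open.
    - by move=> y /f1.
    - by apply: continuous_comp; [exact: (Lh.2 x xs).2|exact: ck].
  apply: (@eq_near_continuous _ _ (k \o h') f x (slit_space (-1))) => //.
  - exact: slit_space_open.
  - by move=> y /f2.
  - by apply: continuous_comp; [exact: (Lh'.2 x xs).2|exact: ck].
(* As 0 lies in [T (i m)], the values of [h] and [h'] at [i m] lie in [G]; hence [f \o i] has
   countable range. *)
have fG m : (k @` G) (f (i m)).
  have [xs|xs] := slit_space_cover (i0 m).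
    rewrite (f1 _ xs); exists (h (i m)) => //.
    by rewrite -[h _]subr0; apply/(TG _ (iM m))/(Lh.2 _ xs).1.
  rewrite (f2 _ xs); exists (h' (i m)) => //.
  by rewrite -[h' _]subr0; apply/(TG _ (iM m))/(Lh'.2 _ xs).1.
have fcst m m' : f (i m) = f (i m').
  apply: (@connected_countable_cst R M setT (f \o i)) => //.
    apply: continuous_subspaceT => x; apply: continuous_comp; [exact: ci|exact: cf].
  apply: (@sub_countable _ _ _ (k @` G)).
    by apply: subset_card_le => _ [x _ <-]; exact: fG.
  exact: sub_countable (card_image_le k G) Gcount.
have e0 : 'e_0 != 0 :> V by apply/rV0Pn; exists 0; rewrite mxE !eqxx oner_neq0.
have [_ [[m0 _ _] _]] := dense _ e0 setT filterT.
(* Near a point where [f] differed from its value on the range of [i], it would keep differing,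
   against density. *)
have fE x : x != 0 -> f x = f (i m0).
  move=> x0; apply/eqP; apply: contrapT => /negP fx.
  have : \forall y \near x, f y != f (i m0).
    have cx : f y @[y --> x] --> f x := cf x x0.
    apply: (cx [set y | y != f (i m0)]); apply: open_nbhs_nbhs.
    by split; [exact: open_neq|].
  by move=> /(dense _ x0)[_ [[m _ <-]]]; rewrite (fcst m m0) eqxx.
have ray u : slit_space 1 (expR u *: 'e_0 : V).
  by left; rewrite !mxE !eqxx mul1r mulr1 expR_gt0.
apply: (knc (f (i m0))) => u.
(* [phi] measures how far [h] is from growing by exactly [v] between [e_0] and [e^v e_0]. It is
   continuous, [G]-valued and 0 at 0, so [h] takes every real value on the ray. *)
pose phi v := h (expR v *: 'e_0) - v - h (expR 0 *: 'e_0).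
have phiG v : G (phi v).
  apply/(TG _ (Lh.2 _ (ray 0)).1).
  have := Tscale (- v) (Lh.2 _ (ray v)).1.
  by rewrite scalerA -expRD addNr.
have phi_cst v : phi v = phi 0.
  apply: (@connected_countable_cst R R setT phi) => //.
  - by apply/connected_intervalP.
  - apply: continuous_subspaceT => x; apply: cvgB; last exact: cvg_cst.
    apply: cvgB; last exact: cvg_id.
    apply: (@continuous_comp _ _ _ (fun v => expR v *: 'e_0) h).
      by apply: cvgZr_tmp; exact: continuous_expR.
    exact: (Lh.2 _ (ray x)).2.
  by apply: sub_countable Gcount; apply: subset_card_le => _ [x _ <-]; exact: phiG.
have -> : u = h (expR (u - h (expR 0 *: 'e_0)) *: 'e_0).
  by have := phi_cst (u - h (expR 0 *: 'e_0)); rewrite /phi; lra.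
rewrite -f1// fE// scaler_eq0 negb_or e0 andbT gt_eqF//; exact: expR_gt0.
Qed.
End DenseRange.

(** * Leaves of a homogeneous foliation and their dilates *)

Section Leaves.
Variables (R : realType) (n : nat) (F : foliation (punctured_space R n)).
Local Notation L i := (carrier (leaf F i)).

Lemma leaf_neq0 i x : L i x -> x != 0.
Proof.
have [cov _ _] := leaf_partition F => Lx.
by suff : punctured_space R n x by []; rewrite -cov; exists i.
Qed.

Lemma leaf_through_eq i x : L i x -> leaf_through F x = L i.
Proof.
have [_ triv _] := leaf_partition F => Lx.
apply/seteqP; split=> [y [j Ljx Ljy]|y Ly]; last by exists i.
by rewrite (triv i j) //; exists x.
Qed.

Hypothesis homF : homogeneous F.

(** A dilate of a leaf is the leaf through any of its points, so one common point identifies it. *)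
Lemma leaf_scale i j x (a : R) : 0 < a -> L i x -> L j (a *: x) ->
  forall y, L i y <-> L j (a *: y).
Proof.
move=> a0 Lx Lax y.
have := homF a0 (leaf_neq0 Lx); rewrite (leaf_through_eq Lx) (leaf_through_eq Lax) => E.
split=> [Ly|]; first by rewrite -E; exists y.
rewrite -E => -[z Lz] /(congr1 (fun u => a^-1 *: u)).
by rewrite !scalerA mulVf ?gt_eqF// !scale1r => <-.
Qed.

Variable i : leaf_index F.

(** The set T(y) of all [s] with [y] in the dilate [e^s L] of the chosen leaf. *)
Definition leaf_offset (y : 'rV[R]_n) : set R := [set s | L i (expR (- s) *: y)].

(** Membership in the group [G] is tested at one point [x] of the leaf: [e^s L = L] exactly when
    [e^s x] is in [L]. *)
Lemma leaf_offset_coset (x : 'rV[R]_n) : L i x -> forall y s s', leaf_offset y s ->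
  leaf_offset y s' <-> L i (expR (s' - s) *: x).
Proof.
move=> Lx y s s' Ls.
have E : expR (s' - s) *: (expR (- s') *: y) = expR (- s) *: y.
  by rewrite scalerA -expRD addrC addrA addNr add0r.
have b0 := expR_gt0 (s' - s).
split=> [Ls'|Lbx].
  by apply: (leaf_scale b0 Ls' _ x).1 => //; rewrite E.
by apply: (leaf_scale b0 Lx Lbx _).2; rewrite E.
Qed.

Lemma leaf_offset_scale y s u : leaf_offset y s -> leaf_offset (expR u *: y) (s + u).
Proof. by rewrite /leaf_offset /= scalerA -expRD opprD subrK. Qed.

(** Dilates of the leaf [L j] through [x] sweep out a box around [x]. By density the box contains a
    point [y] of [L i], so [L i] is [L j] dilated by [rho y], and each [z] in the box lies in [L i]
    dilated by [rho z / rho y]. *)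
Lemma leaf_offset_liftable :
  (forall j, (im_dim (leaf F j)).+1 = n) -> transversal_to_radial F ->
  all_leaves_dense F -> locally_liftable leaf_offset [set x | x != 0].
Proof.
move=> dimF trF dense x x0.
have [cov _ _] := leaf_partition F.
have [j _ [m _ mx]] : cover setT (fun j => L j) x by rewrite cov.
have [U [rho [oU Um UP]]] := radial_box (dimF j) (trF j m).
have [y [Ly Uy]] := dense i x x0 U (open_nbhs_nbhs (conj oU (eq_ind _ U Um _ mx))).
have [ry _ Ljy] := UP y Uy.
exists U; first by rewrite -mx.
exists (fun z => ln (rho z) - ln (rho y)); split=> // z Uz.
have [rz crho Ljz] := UP z Uz; split; last first.
  have cln : {for z, continuous (@ln R \o rho)}.
    by apply: continuous_comp => //; exact: continuous_ln.
  exact: cvgB cln (cvg_cst _).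
rewrite /leaf_offset /= opprB expRD expRN !lnK ?posrE//.
have r0 : 0 < (rho y)^-1 by rewrite invr_gt0.
apply/(leaf_scale r0 Ly Ljy).
by rewrite scalerA mulrA mulVf ?mul1r// gt_eqF.
Qed.

End Leaves.

Theorem lemma9 (R : realType) (n : nat) (hn : (2 <= n)%N) :
  ~ exists F : foliation (punctured_space R n),
      [/\ homogeneous F, codimension_one_regular F,
          transversal_to_radial F & all_leaves_dense F].
Proof.
case: n hn => [|[|n]] // _ [F [homF [d dn [dimF _]] trF dense]].
have dimF' j : (im_dim (leaf F j)).+1 = n.+2 by rewrite dimF.
have [cov _ _] := leaf_partition F.
have e0 : punctured_space R n.+2 'e_0.
  by apply/rV0Pn; exists 0; rewrite mxE !eqxx oner_neq0.
have [i _ [m _ mE]] : cover setT (fun j => carrier (leaf F j)) 'e_0.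
  by rewrite cov.
have Lm : carrier (leaf F i) (im_incl m) by exists m.
(* The leaf through [e_0] plays the role of [L], and its point [m] serves as the base point that
   defines [G]. *)
apply: (@range_not_dense R n (leaf_offset i)
  [set s | carrier (leaf F i) (expR s *: im_incl m)]
  (im_space (leaf F i)) (@im_incl _ _ (leaf F i))) (dense i).
- by apply: countable_ray => // m'; exact: trF.
- exact: leaf_offset_coset.
- exact: leaf_offset_scale.
- exact: leaf_offset_liftable.
- exact: im_incl_continuous.
- exact: leaf_connected.
- by move=> m'; rewrite /leaf_offset /= oppr0 expR0 scale1r; exists m'.
- by move=> m'; apply: leaf_neq0; exists m'.
Qed.
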